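(* Let $G$ be a Lévy group which acts boundedly and by uniform isomorphisms on a metric space $X$ having the property ($\lozenge$). Then for any compact subset $K\subseteq G$ and any $\varepsilon>0$ there exists a point $x_{\varepsilon,K}\in X$ such that $\operatorname{diam}(K x_{\varepsilon,K})\leq \varepsilon$, where $Kx:=\{gx\mid g\in K\}$.
   Context: An mm-space is a complete separable metric space $(X,d_X)$ with a finite Borel measure $\mu_X$; put $m_X:=\mu_X(X)$. For a finite Borel measure $\nu$ on a metric space $Y$ with $m=\nu(Y)$ and $\kappa>0$, $\operatorname{diam}(\nu,m-\kappa):=\inf\{\operatorname{diam}Y_0\mid Y_0\subseteq Y \text{ Borel},\ \nu(Y_0)\geq m-\kappa\}$. For an mm-space $X$, a metric space $Y$ and $\kappa>0$, $\operatorname{ObsDiam}_Y(X;-\kappa):=\sup\{\operatorname{diam}(f_*(\mu_X),m_X-\kappa)\mid f:X\to Y \text{ is } 1\text{-Lipschitz}\}$. A sequence $\{X_n\}$ of mm-spaces is a Lévy family if $\lim_{n\to\infty}\operatorname{ObsDiam}_{\mathbb{R}}(X_n;-\kappa)=0$ for every $\kappa>0$. A metrizable group $G$ is a Lévy group if it contains an increasing chain of compact subgroups $G_1\subseteq G_2\subseteq\cdots$ with everywhere dense union in $G$ such that, for some right-invariant compatible distance function $d_G$ on $G$, the groups $G_n$, equipped with the normalized Haar measures $\mu_{G_n}$ ($\mu_{G_n}(G_n)=1$) and the restrictions of $d_G$, form a Lévy family. An action of a topological group $G$ on a metric space $X$ is bounded if for any $\varepsilon>0$ there is a neighbourhood $U$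 of the identity $e_G$ such that $d_X(x,gx)<\varepsilon$ for all $g\in U$ and $x\in X$. $G$ acts by uniform isomorphisms if for each $g\in G$ the map $X\ni x\mapsto gx\in X$ is uniformly continuous. A metric space $X$ has the property ($\lozenge$) if $\lim_{n\to\infty}\operatorname{ObsDiam}_X(X_n;-\kappa)=0$ for any $\kappa>0$ and any Lévy family $\{X_n\}_{n=1}^\infty$. *)

(* Defs.v *)
From HB Require Import structures.
From mathcomp Require Import all_boot all_order all_algebra.
From mathcomp Require Import all_classical all_reals all_analysis.

Set Implicit Arguments.
Unset Strict Implicit.
Unset Printing Implicit Defensive.

Import Order.TTheory GRing.Theory Num.Theory.
Import numFieldNormedType.Exports.

Local Open Scope classical_set_scope.
Local Open Scope ring_scope.

Section diameters.
Context {R : realType}.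

(* [0] is added so that the diameter of the empty set is 0 and not -oo. *)
Definition diam (Y : metricType R) (A : set Y) : \bar R :=
  ereal_sup ([set 0%E] `|` [set (mdist p.1 p.2)%:E | p in A `*` A]).

Definition borel (Y : topologicalType) : set (set Y) := <<s @open Y >>.

(* diam(nu, a); it is used with a := nu(Y) - kappa. *)
Definition partial_diam (Y : metricType R) (nu : set Y -> \bar R) (a : \bar R) :
    \bar R :=
  ereal_inf [set diam Y0 | Y0 in [set Y0 | borel Y0 /\ (a <= nu Y0)%E]].

Definition lipschitz1 (Y Z : metricType R) (f : Y -> Z) : Prop :=
  forall x y, mdist (f x) (f y) <= mdist x y.

End diameters.

(* The measurable types of the library are pointed, hence so are the spaces on
   which measures are considered. *)
#[short(type="pmetricType")]
HB.structure Definition PointedMetric (K : numDomainType) :=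
  {M of Pointed M & Metric K M}.

Definition complete_space (T : puniformType) : Prop :=
  forall F : set_system T, ProperFilter F -> cauchy F -> cvg F.

Definition separable_space (T : topologicalType) : Prop :=
  exists2 D : set T, countable D & dense D.

Record mmSpace (R : realType) := MMSpace {
  mm_space :> pmetricType R ;
  mm_complete : complete_space mm_space ;
  mm_separable : separable_space mm_space ;
  mm_measure :
    {finite_measure set (g_sigma_algebraType (@open mm_space)) -> \bar R} }.

Section levy.
Context {R : realType}.

(* ObsDiam_Y(X; -kappa). For Y empty this is a supremum over the empty set,
   i.e. -oo, so that [property_lozenge] below fails for the empty space. *)
Definition ObsDiam (Y : metricType R) (X : mmSpace R) (kappa : R) : \bar R :=
  ereal_sup [set partial_diam (fun A : set Y => mm_measure X (f @^-1` A))
                   (mm_measure X setT - kappa%:E)%E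
            | f in [set f : X -> Y | lipschitz1 f]].

(* R^o is the real line R seen as a metric space. *)
Definition levy_family (X : nat -> mmSpace R) : Prop :=
  forall kappa : R, 0 < kappa ->
    (fun n => ObsDiam R^o (X n) kappa) @ \oo --> 0%E.

Definition property_lozenge (Y : metricType R) : Prop :=
  forall X : nat -> mmSpace R, levy_family X ->
  forall kappa : R, 0 < kappa ->
    (fun n => ObsDiam Y (X n) kappa) @ \oo --> 0%E.

End levy.

HB.mixin Record isTopologicalGroup G & Group G & Topological G := {
  mulg_continuous : continuous (fun x : G * G => (x.1 * x.2)%g) ;
  invg_continuous : continuous (fun x : G => (x^-1)%g) }.

#[short(type="topologicalGroupType")]
HB.structure Definition TopologicalGroup :=
  {G of Group G & Topological G & isTopologicalGroup G}.

Section distances.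
Context {R : realType} (G : topologicalGroupType).
Implicit Types (d : G -> G -> R) (A : set G).

Record is_distance d : Prop := IsDistance {
  dist_xx : forall x, d x x = 0 ;
  dist_eq0 : forall x y, d x y = 0 -> x = y ;
  dist_sym : forall x y, d x y = d y x ;
  dist_triangle : forall y x z, d x z <= d x y + d y z }.

Definition compatible_distance d : Prop :=
  forall (x : G) (U : set G),
    nbhs x U <-> exists2 e : R, 0 < e & [set y | d x y < e] `<=` U.

Definition right_invariant d : Prop :=
  forall x y g, d (x * g)%g (y * g)%g = d x y.

Record compact_subgroup A : Prop := CompactSubgroup {
  csubg_compact : compact A ;
  csubg1 : A 1%g ;
  csubgM : forall x y, A x -> A y -> A (x * y)%g ;
  csubgV : forall x, A x -> A (x^-1)%g }.

End distances.

Section subgroup_mm_space.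
Context {R : realType} {G : topologicalGroupType} {d : G -> G -> R} {A : set G}.

(* The set A as a metric space, for the restriction of d. *)
Definition subgroup_space (dd : is_distance d) (cA : compact_subgroup A) : Type :=
  set_type A.

Context (dd : is_distance d) (cA : compact_subgroup A).
Notation T := (subgroup_space dd cA).

Definition subg_val (x : T) : G := set_val x.

Definition subg_dist (x y : T) : R := d (subg_val x) (subg_val y).

HB.instance Definition _ := Choice.on T.

HB.instance Definition _ :=
  isPointed.Build T (exist _ 1%g (mem_set (csubg1 cA)) : set_type A).

Fact subg_dist_xx x : subg_dist x x = 0. Proof. exact: dist_xx. Qed.

Fact subg_dist_eq0 x y : subg_dist x y = 0 -> x = y.
Proof. by move=> /(dist_eq0 dd) xy; apply: val_inj. Qed.

Fact subg_dist_sym x y : subg_dist x y = subg_dist y x.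
Proof. exact: dist_sym. Qed.

Fact subg_dist_triangle y x z :
  subg_dist x z <= subg_dist x y + subg_dist y z.
Proof. exact: dist_triangle. Qed.

HB.instance Definition _ := @isMetric.Build R T subg_dist
  subg_dist_xx subg_dist_eq0 subg_dist_sym subg_dist_triangle.

Context (dc : compatible_distance d).

Lemma subg_space_compact : compact [set: T].
Proof.
move=> F FF _.
have FA : (subg_val @ F) A.
  by apply: (@filterE _ F _ (subg_val @^-1` A)) => -[x Ax]; apply: set_mem Ax.
have [x [Ax clx]] := csubg_compact cA _ FA.
exists (exist _ x (mem_set Ax) : set_type A); split=> // B C FB.
rewrite -metricType_numDomainType.filter_from_mdist_nbhs => -[e /= e0 eC].
have nx : nbhs x [set y | d x y < e] by apply/dc; exists e.
have FB' : (subg_val @ F) (subg_val @` B).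
  by apply: (@filterS _ F _ B (subg_val @^-1` (subg_val @` B))) => // y By;
    exists y.
have [_ [[y By <-] dy]] := clx _ _ FB' nx.
by exists y; split=> //; exact: eC.
Qed.

Lemma subg_space_complete : complete_space T.
Proof.
by move=> F FF Fc; apply: (compact_cauchy_cvg FF Fc) subg_space_compact; exact: filterT.
Qed.

Lemma subg_space_separable : separable_space T.
Proof.
have [B cB [oB bB]] := compact_second_countable subg_space_compact.
exists (get @` B); first exact: card_le_trans (card_image_le _ _) cB.
move=> O [x Ox] oO.
have [U [BU Ux] UO] := bB x O (open_nbhs_nbhs (conj oO Ox)).
exists (get U); split; last by exists U.
by apply: UO; apply: getPex; exists x.
Qed.

Definition subgroup_mm_space
    (mu : {finite_measure set (g_sigma_algebraType (@open T)) -> \bar R}) :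
    mmSpace R :=
  MMSpace subg_space_complete subg_space_separable mu.

(* Left-invariance and total mass 1 characterize the Haar measure, because every
   finite Borel measure on a compact metric space is regular. The set in the
   second clause is the translate g B. *)
Definition normalized_haar
    (mu : {finite_measure set (g_sigma_algebraType (@open T)) -> \bar R}) :
    Prop :=
  mu setT = 1%E /\
  forall (g : G) (B : set T), A g -> borel B ->
    mu [set x : T | exists2 y : T, B y & subg_val x = (g * subg_val y)%g] = mu B.

End subgroup_mm_space.

Definition levy_group (R : realType) (G : topologicalGroupType) : Prop :=
  exists (H : nat -> set G) (cH : forall n, compact_subgroup (H n)),
    [/\ forall n, H n `<=` H n.+1,
        dense (\bigcup_n H n) &
        exists (d : G -> G -> R) (dd : is_distance d) (dc : compatible_distance d)
          (mu : forall n, {finite_measure set (g_sigma_algebraType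
                   (@open (subgroup_space dd (cH n)))) -> \bar R}),
          [/\ right_invariant d,
              forall n, normalized_haar (mu n) &
              levy_family (fun n => subgroup_mm_space dc (mu n))]].

Section actions.
Context {R : realType} {G : topologicalGroupType} {X : metricType R}.
Implicit Type act : G -> X -> X.

Record is_group_action act : Prop := IsGroupAction {
  act1 : forall x, act 1%g x = x ;
  actM : forall g h x, act (g * h)%g x = act g (act h x) }.

Definition bounded_action act : Prop :=
  forall e : R, 0 < e ->
    exists2 U : set G, nbhs 1%g U & forall g x, U g -> mdist x (act g x) < e.

Definition acts_by_uniform_isomorphisms act : Prop :=
  forall g, unif_continuous (act g).

End actions.

(* Main.v *)
(** Fix a point x0. By boundedness and right invariance, the orbit map g |-> g x0
    is uniformly continuous for d, so d'(g, h) := d(g, h) + d_X(g x0, h x0) is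
    again a compatible distance on G, uniformly equivalent to d, for which the
    orbit map is 1-Lipschitz. The groups G_n remain a Lévy family for d', so
    property (lozenge) gives a small set B in X that contains h x0 for all h in
    G_n outside a set of small Haar measure. Boundedness again allows K to be
    replaced by a finite subset s of some G_n; by left invariance, some h in G_n
    has g h x0 in B for every g in s, and h x0 is the required point. *)
From HB Require Import structures.
Require Import Defs.
From mathcomp Require Import all_boot all_order all_algebra.
From mathcomp Require Import all_classical all_reals all_analysis.
From mathcomp Require Import lra.

Set Implicit Arguments.
Unset Strict Implicit.
Unset Printing Implicit Defensive.

Import Order.TTheory GRing.Theory Num.Theory.
Import numFieldNormedType.Exports.

Local Open Scope classical_set_scope.
Local Open Scope ring_scope.

(** * Diameters, Borel sets, continuity and limits at 0 in the extended reals *)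

Section diameters.
Context {R : realType}.

Lemma diam_ge0 (Y : metricType R) (A : set Y) : (0 <= diam A)%E.
Proof. by apply: ereal_sup_ubound; left. Qed.

Lemma mdist_le_diam (Y : metricType R) (A : set Y) x y :
  A x -> A y -> ((mdist x y)%:E <= diam A)%E.
Proof. by move=> Ax Ay; apply: ereal_sup_ubound; right; exists (x, y). Qed.

Lemma diam_le (Y : metricType R) (A : set Y) (r : R) : 0 <= r ->
  (forall x y, A x -> A y -> mdist x y <= r) -> (diam A <= r%:E)%E.
Proof.
move=> r0 Ar; apply: ge_ereal_sup => _ [->|[[x y] [/= Ax Ay] <-]];
  by rewrite lee_fin //; exact: Ar.
Qed.

Lemma partial_diam_ge0 (Y : metricType R) nu (a : \bar R) :
  (0 <= @partial_diam R Y nu a)%E.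
Proof. by apply: le_ereal_inf_tmp => _ [B _ <-]; exact: diam_ge0. Qed.

Lemma borel_preimage (X Y : topologicalType) (f : X -> Y) (B : set Y) :
  continuous f -> borel B -> borel (f @^-1` B).
Proof.
move=> /continuousP fc.
have sa : sigma_algebra setT (image_set_system setT f (borel (Y:=X))).
  by apply: sigma_algebra_image; exact: smallest_sigma_algebra.
have H := @smallest_sub _ _ open _ sa.
move=> /H; rewrite /image_set_system /= setTI; apply => U oU /=.
by rewrite setTI; apply: sub_sigma_algebra; exact: fc.
Qed.

Lemma borel_closed (X : topologicalType) (B : set X) : closed B -> borel B.
Proof.
move=> cB; rewrite -(setCK B) -setTD; apply: sigma_algebraCD.
by apply: sub_sigma_algebra; exact: closed_openC.
Qed.

Lemma metric_unif_continuous (X Y : metricType R) (f : X -> Y) :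
  (forall e : R, 0 < e -> exists2 dl : R, 0 < dl &
    forall x y, mdist x y < dl -> mdist (f x) (f y) < e) ->
  continuous f.
Proof.
move=> fu x; apply/metricType_numDomainType.cvgrPdist_lt => e /fu[dl dl0 fdl].
by apply/metricType_numDomainType.nbhs_mdistP; exists dl => //= y; exact: fdl.
Qed.

Lemma lipschitz1_continuous (X Y : metricType R) (f : X -> Y) :
  lipschitz1 f -> continuous f.
Proof.
move=> fl; apply: metric_unif_continuous => e e0; exists e => // x y.
exact: le_lt_trans.
Qed.

Lemma ereal_cvg0_lt (u : nat -> \bar R) (e : R) : u @ \oo --> 0%E -> 0 < e ->
  \forall n \near \oo, (u n < e%:E)%E.
Proof.
move=> u0 e0; apply: (u0 [set y | (y < e%:E)%E]).
by apply: open_ereal_lt'; rewrite lte_fin.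
Qed.

Lemma ereal_cvg0 (u : nat -> \bar R) : (forall n, (0 <= u n)%E) ->
  (forall e : R, 0 < e -> \forall n \near \oo, (u n <= e%:E)%E) ->
  u @ \oo --> 0%E.
Proof.
move=> u0 ue A nA.
have /nbhs_ballP[e /= e0 eA] : nbhs (0 : R) [set r | A r%:E] by [].
suff : \forall n \near \oo, A (u n) by [].
near=> n.
have : (u n <= (e / 2)%:E)%E by near: n; apply: ue; rewrite divr_gt0.
have := u0 n; case: (u n) => [r| |] //=.
rewrite !lee_fin => r0 re; apply: eA.
rewrite /ball /= sub0r normrN ger0_norm //.
by apply: le_lt_trans re _; rewrite ltr_pdivrMr // mulr2n mulrDr mulr1 ltrDl.
Unshelve. all: by end_near. Qed.

End diameters.

(** * Observable diameter *)

Section mm_spaces.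
Context {R : realType}.
Implicit Types X : mmSpace R.

Lemma ObsDiam_ge0 (Y : metricType R) (y : Y) X k : (0 <= ObsDiam Y X k)%E.
Proof.
apply: (le_trans (partial_diam_ge0 _ _)); apply: ereal_sup_ubound.
exists (fun=> y) => //= a b.
by rewrite mdistxx mdist_ge0.
Qed.

(** The strict bound passes through the supremum over maps and then yields an actual set from the
    infimum in [partial_diam]. *)
Lemma ObsDiam_lt (Y : metricType R) X k e (f : X -> Y) :
  lipschitz1 f -> (ObsDiam Y X k < e)%E ->
  exists B, [/\ borel B,
    (mm_measure X setT - k%:E <= mm_measure X (f @^-1` B))%E & (diam B < e)%E].
Proof.
move=> fl Xe.
have /ereal_inf_lt[_ [B [bB mB] <-] Be] :
    (partial_diam (fun A => mm_measure X (f @^-1` A))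
      (mm_measure X setT - k%:E) < e)%E.
  by apply: le_lt_trans Xe; apply: ereal_sup_ubound; exists f.
by exists B.
Qed.

End mm_spaces.

(** * Measures of total mass 1: intersections and medians *)

Section unit_mass.
Context d (T : measurableType d) {R : realType}
  (m : {finite_measure set T -> \bar R}).
Hypothesis m1 : m setT = 1%E.

Lemma unit_mass_setC B : measurable B -> m (~` B) = (1 - m B)%E.
Proof.
move=> mB; rewrite -setTD measureD //; last by rewrite [X in (X < _)%E]m1 ltry.
by rewrite setTI [X in (X - _)%E]m1.
Qed.

(** Passes from the form in which [partial_diam] bounds masses to a bound on the complement, where
    subadditivity applies. *)
Lemma unit_mass_setC_le B (k : R) : measurable B ->
  ((m (~` B) <= k%:E) = (1 - k%:E <= m B))%E.
Proof.
move=> mB; rewrite unit_mass_setC //.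
have /fineK <- := fin_num_measure m B mB.
by rewrite -!EFinB !lee_fin !lerBlDr addrC.
Qed.

Lemma unit_mass_meet A B : measurable A -> measurable B ->
  (m (~` A) + m (~` B) < 1)%E -> A `&` B !=set0.
Proof.
move=> mA mB; rewrite ltNge => /negP AB; apply/set0P/negP => /eqP AB0; apply: AB.
by rewrite -m1 -setC0 -AB0 setCI; apply: measureU2; exact: measurableC.
Qed.

(** Union bound: the complements together have mass less than 1, so they cannot cover the space. *)
Lemma unit_mass_meet_seq (I : eqType) (s : seq I) (B : I -> set T) (k : R) :
  (forall i, i \in s -> measurable (B i)) ->
  (forall i, i \in s -> (m (~` B i) <= k%:E)%E) -> k *+ size s < 1 ->
  exists x, forall i, i \in s -> B i x.
Proof.
move=> mB Bk ks.
have [mA Ak] : measurable (\big[setI/setT]_(i <- s) B i) /\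
    (m (~` \big[setI/setT]_(i <- s) B i) <= (k *+ size s)%:E)%E.
  elim: s mB Bk {ks} => [|i s IHs] mB Bk.
    by rewrite big_nil setCT measure0; split.
  have [||mA Ak] := IHs.
  - by move=> j js; apply: mB; rewrite in_cons js orbT.
  - by move=> j js; apply: Bk; rewrite in_cons js orbT.
  have mBi : measurable (B i) by apply: mB; rewrite mem_head.
  rewrite big_cons; split; first exact: measurableI.
  rewrite setCI mulrS EFinD; apply: (le_trans (measureU2 _ _ _)).
  - exact: measurableC.
  - exact: measurableC.
  - by apply: leeD => //; apply: Bk; rewrite mem_head.
(* Meeting with [setT], whose complement has mass 0, turns the mass bound into a point. *)
have [x [Ax _]] : (\big[setI/setT]_(i <- s) B i) `&` setT !=set0.
  apply: unit_mass_meet => //; rewrite setCT measure0 adde0.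
  by apply: le_lt_trans Ak _; rewrite lte_fin.
exists x => i si; move: Ax; rewrite (big_rem i) //=.
by case.
Qed.

(** The median is the infimum of the levels [t] below which [g] stays with mass at least 1/2. The
    slack [e] spares a continuity argument for the measure at the level [c] itself. *)
Lemma unit_mass_median (g : T -> R) :
  (forall t, measurable [set x | g x <= t]) ->
  (forall t, measurable [set x | t <= g x]) ->
  exists c, forall e, 0 < e -> ((2^-1)%:E <= m [set x | (g x <= c + e)%R])%E /\
                               ((2^-1)%:E <= m [set x | (c - e <= g x)%R])%E.
Proof.
move=> mle mge.
have mI (a b : R) : measurable [set x | a <= g x <= b].
  rewrite (_ : [set _ | _] = [set x | a <= g x] `&` [set x | g x <= b]).
    exact: measurableI.
  by apply/seteqP; split=> x /= /andP.
(* Continuity from below along the sets where |g| <= n; this [n] makes the set [S] of levels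
   nonempty and bounded below. *)
have [n ltn] : exists n, ((2^-1)%:E < m [set x | (- n%:R <= g x <= n%:R)%R])%E.
  pose F n := [set x | - n%:R <= g x <= n%:R].
  have FT : \bigcup_n F n = setT.
    rewrite -subTset => x _; exists (Num.truncn `|g x|).+1 => //=.
    by rewrite /F /= -ler_norml ltW // truncnS_gt.
  have Fcvg : m \o F @ \oo --> m (\bigcup_n F n).
    have mF i : measurable (F i) by exact: mI.
    apply: nondecreasing_cvg_mu => //; first exact: bigcupT_measurable.
    move=> i j ij; apply/subsetPset => x /= /andP[x1 x2]; apply/andP.
    have ij' : i%:R <= j%:R :> R by rewrite ler_nat.
    by split; lra.
  rewrite FT m1 in Fcvg.
  have : \forall n \near \oo, ((2^-1)%:E < m (F n))%E.
    apply: (Fcvg [set y | ((2^-1)%:E < y)%E]); apply: open_ereal_gt'.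
    by rewrite lte_fin; lra.
  by move=> [n _ Fn]; exists n; apply: Fn => /=.
pose S := [set t | ((2^-1)%:E <= m [set x | (g x <= t)%R])%E].
have Sn : S n%:R.
  apply: (le_trans (ltW ltn)); apply: le_measure; rewrite ?inE //.
  by move=> x /= /andP[].
(* A level below -n in [S] would give disjoint sets of mass at least 1/2 and more than 1/2. *)
have Slb : lbound S (- n%:R).
  move=> t St; rewrite leNgt; apply/negP => tn.
  have [|x [/= x1 /andP[x2 x3]]] := @unit_mass_meet _ _ (mle t) (mI (- n%:R) n%:R).
    rewrite (_ : 1 = (2^-1)%:E + (2^-1)%:E)%E; last first.
      by rewrite -EFinD; congr EFin; lra.
    apply: lee_ltD => //.
    - by apply: fin_num_measure; exact: measurableC.
    - rewrite unit_mass_setC_le //; apply: le_trans St.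
      by rewrite -EFinB lee_fin; lra.
    - rewrite unit_mass_setC //.
      move: ltn; have /fineK <- := fin_num_measure m _ (mI (- n%:R) n%:R).
      by rewrite -!EFinB !lte_fin => ?; lra.
  by move: (le_lt_trans x1 tn); rewrite ltNge x2.
have Slow : has_lbound S by exists (- n%:R).
exists (inf S) => e e0; split.
  have [|t St te] := @inf_adherent _ S e e0; first by split; [exists n%:R|].
  apply: (le_trans St); apply: le_measure; rewrite ?inE // => x /= xt.
  by lra.
have nS : ~ S (inf S - e).
  by move=> /(ge_inf Slow); lra.
have mC : measurable (~` [set x | g x <= inf S - e]) by exact: measurableC.
apply: (@le_trans _ _ (m (~` [set x | g x <= inf S - e]))).
  rewrite unit_mass_setC //; move/negP: nS; rewrite /S /= -ltNge.
  have /fineK <- := fin_num_measure m _ (mle (inf S - e)).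
  by rewrite -!EFinB lte_fin lee_fin => ?; lra.
apply: le_measure; rewrite ?inE // => x /= /negP; rewrite -ltNge.
exact: ltW.
Qed.

End unit_mass.

(** * Concentration of measure and Lévy families *)

Section concentration.
Context {R : realType}.

Section distance_to_a_set.
Variables (X : metricType R) (A : set X).

(** Valued in [R^o], so that it is a test function for [ObsDiam R^o]. *)
Definition dist_set (x : X) : R^o := inf [set mdist x a | a in A].

Let lb0 x : lbound [set mdist x a | a in A] 0.
Proof. by move=> _ [a _ <-]; exact: mdist_ge0. Qed.

Lemma dist_set_mem a : A a -> dist_set a = 0.
Proof.
move=> Aa; apply/eqP; rewrite eq_le; apply/andP; split.
  by apply: ge_inf; [exists 0; exact: lb0|exists a => //; exact: mdistxx].
by apply: lb_le_inf; [exists (mdist a a), a|exact: lb0].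
Qed.

Lemma dist_set_lt x (e : R) : A !=set0 -> dist_set x < e ->
  exists2 a, A a & mdist x a < e.
Proof.
move=> [a Aa] /inf_lt[|_ [b Ab <-] xb]; first by exists (mdist x a), a.
by exists b.
Qed.

Lemma dist_set_lipschitz1 : A !=set0 -> lipschitz1 dist_set.
Proof.
move=> [a0 Aa0].
have le x y : dist_set y - dist_set x <= mdist x y.
  rewrite lerBlDr -lerBlDl.
  apply: lb_le_inf => [|_ [a Aa <-]]; first by exists (mdist x a0), a0.
  rewrite lerBlDl [mdist x y]metric_sym; apply: le_trans (metric_triangle _ x _).
  by apply: ge_inf; [exists 0; exact: lb0|exists a].
move=> x y; rewrite /mdist /= ler_norml le andbT lerNl opprB.
by rewrite [X in _ <= X]metric_sym.
Qed.

End distance_to_a_set.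

(** The distance to [A] takes its values, off mass [k], in a set of diameter less than [dl]. Since
    [A] has mass at least 1/2 and [k] is below 1/2, that set contains the value 0, so all its values
    are less than [dl]. *)
Lemma obs_diam_concentration (X : mmSpace R) (k dl : R) (A : set X) :
  mm_measure X setT = 1%E -> borel A -> ((2^-1)%:E <= mm_measure X A)%E ->
  k < 2^-1 -> (ObsDiam R^o X k < dl%:E)%E ->
  exists B, [/\ borel B, (mm_measure X (~` B) <= k%:E)%E &
    forall x, B x -> exists2 a, A a & mdist x a < dl].
Proof.
move=> X1 bA A2 k2 Xk.
have A0 : A !=set0.
  apply/set0P/negP => /eqP A0; move: A2; rewrite A0 measure0 lee_fin leNgt.
  by move=> /negP; apply; lra.
have lipA := dist_set_lipschitz1 A0.
have [B [bB muB dB]] := ObsDiam_lt lipA Xk.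
have bgB : borel (dist_set A @^-1` B).
  by apply: borel_preimage bB; exact: lipschitz1_continuous.
have mugB : (mm_measure X (~` (dist_set A @^-1` B)) <= k%:E)%E.
  by rewrite (unit_mass_setC_le X1) //; move: muB; rewrite X1.
have [a [Aa Ba]] : A `&` (dist_set A @^-1` B) !=set0.
  apply: (unit_mass_meet X1) => //.
  apply: (@le_lt_trans _ _ ((2^-1)%:E + k%:E)%E).
    apply: leeD => //; rewrite (unit_mass_setC_le X1) //.
    by apply: le_trans A2; rewrite -EFinB lee_fin; lra.
  by rewrite -EFinD lte_fin; lra.
exists (dist_set A @^-1` B); split=> // x Bx.
apply: dist_set_lt => //.
have := le_lt_trans (@mdist_le_diam _ _ B _ _ Ba Bx) dB.
rewrite lte_fin /mdist /= (dist_set_mem Aa) subr0.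
exact: le_lt_trans (ler_norm _).
Qed.

(* A 1-Lipschitz function on the target need not be Lipschitz on the source; so
   it is compared with its median, by concentration around the two half spaces
   cut out by the median. *)
Lemma levy_family_uniform_image (X X' : nat -> mmSpace R)
    (p : forall n, X n -> X' n) :
  (forall n, mm_measure (X n) setT = 1%E) ->
  (forall n B, borel B ->
    mm_measure (X' n) B = mm_measure (X n) (p n @^-1` B)) ->
  (forall e : R, 0 < e -> exists2 dl : R, 0 < dl &
    forall n x y, mdist x y < dl -> mdist (p n x) (p n y) < e) ->
  levy_family X -> levy_family X'.
Proof.
move=> X1 pE pU XL k k0.
have pc n : continuous (p n).
  apply: metric_unif_continuous => e /pU[dl dl0 pdl].
  by exists dl => // x y; exact: pdl.
apply: ereal_cvg0 => [n|e e0]; first exact: ObsDiam_ge0 (0 : R^o) _ _.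
(* Each of the two half spaces costs mass [k']: at most [k] in total, and below 1/2 as
   [obs_diam_concentration] requires. *)
pose k' := Num.min (k / 2) (4^-1 : R).
have k'0 : 0 < k' by rewrite lt_min; apply/andP; split; lra.
have k'k : k' <= k / 2 by rewrite ge_min lexx.
have k'2 : k' < 2^-1.
  have : k' <= 4^-1 by rewrite ge_min lexx orbT.
  by lra.
(* One quarter is the slack of the median, another bounds the variation of [g] over distances below
   [dl]; hence the half-width e / 2 of the interval [B] below. *)
have e4 : 0 < e / 4 by lra.
have [dl dl0 pdl] := pU _ e4.
apply: filterS (ereal_cvg0_lt (XL _ k'0) dl0) => n Xn.
apply: ge_ereal_sup => _ [f flip <-].
have fc : continuous (f : X' n -> R^o) by exact: lipschitz1_continuous.
pose g x : R := f (p n x).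
have gc : continuous (g : X n -> R^o).
  by move=> x; apply: continuous_comp; [exact: pc|exact: fc].
have ble t : borel [set x | g x <= t].
  apply: (borel_preimage gc (B := [set y : R^o | y <= t])).
  by apply: borel_closed; exact: closed_le.
have bge t : borel [set x | t <= g x].
  apply: (borel_preimage gc (B := [set y : R^o | t <= y])).
  by apply: borel_closed; exact: closed_ge.
have [c /(_ _ e4)[cle cge]] := unit_mass_median (X1 n) ble bge.
have [B1 [bB1 muB1 B1A]] := obs_diam_concentration (X1 n) (ble _) cle k'2 Xn.
have [B2 [bB2 muB2 B2A]] := obs_diam_concentration (X1 n) (bge _) cge k'2 Xn.
pose B := [set y : R^o | c - e / 2 <= y] `&` [set y : R^o | y <= c + e / 2].
have cB : closed B by apply: closedI; [exact: closed_ge|exact: closed_le].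
have bB := borel_closed cB.
have X'1 : mm_measure (X' n) setT = 1%E.
  rewrite pE ?preimage_setT ?X1 //; exact: borel_closed closedT.
apply: (@le_trans _ _ (diam B)).
  apply: ereal_inf_lbound; exists B => //; split=> //.
  have bfB : borel (f @^-1` B) by exact: borel_preimage bB.
  rewrite X'1 -(unit_mass_setC_le X'1) // pE; last first.
    by rewrite -setTD; exact: sigma_algebraCD.
  have bgB : borel (g @^-1` B) by exact: borel_preimage bB.
  apply: (@le_trans _ _ (mm_measure (X n) (~` B1 `|` ~` B2))).
    apply: le_measure; rewrite ?inE.
    - by apply: measurableC; exact: bgB.
    - by apply: measurableU; apply: measurableC; [exact: bB1|exact: bB2].
    (* A point of both [B1] and [B2] is [dl]-close to a point of each half space, which bounds [g]
       there from both sides. *)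
    rewrite -setCI preimage_setC; apply: subsetC => x [/B1A + /B2A].
    move=> [a1 /= ga1 xa1] [a2 /= ga2 xa2]; rewrite /B /=.
    have fp a : mdist x a < dl -> `|g a - g x| < e / 4.
      by move=> /pdl; apply: le_lt_trans; exact: flip.
    move: (fp _ xa1) (fp _ xa2); rewrite !ltr_norml => /andP[? ?] /andP[? ?].
    by rewrite -[f (p n x)]/(g x); split; lra.
  have mC1 := @measurableC _ (g_sigma_algebraType (@open (X n))) _ bB1.
  have mC2 := @measurableC _ (g_sigma_algebraType (@open (X n))) _ bB2.
  apply: (le_trans (@measureU2 _ _ _ (mm_measure (X n)) _ _ mC1 mC2)).
  apply: (@le_trans _ _ (k'%:E + k'%:E)%E); first exact: leeD.
  by rewrite -EFinD lee_fin; lra.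
apply: diam_le => [|x y [/= x1 x2] [/= y1 y2]]; first exact: ltW.
by rewrite /mdist /= ler_norml; apply/andP; split; lra.
Qed.

End concentration.

(** * Push-forward of finite measures *)

Section pushforward_finite.
Context d1 d2 {T1 : measurableType d1} {T2 : measurableType d2} {R : realType}.
Variables (f : T1 -> T2) (mf : measurable_fun [set: T1] f)
  (mu : {finite_measure set T1 -> \bar R}).

Let map := pushforward mu f.

Let map0 : map set0 = 0%E. Proof. exact: measure0. Qed.

Let map_ge0 A : (0 <= map A)%E. Proof. exact: measure_ge0. Qed.

Let map_sigma_additive : semi_sigma_additive map.
Proof. exact: measure_semi_sigma_additive. Qed.

HB.instance Definition _ := isMeasure.Build _ _ _ map
  map0 map_ge0 map_sigma_additive.

Let map_fin : fin_num_fun map.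
Proof.
move=> B mB; apply: fin_num_measure; rewrite -[X in measurable X]setTI.
exact: mf.
Qed.

HB.instance Definition _ := Measure_isFinite.Build _ _ _ map map_fin.

Definition finite_pushforward : {finite_measure set T2 -> \bar R} := map.

End pushforward_finite.

Lemma continuous_borel_measurable (S T : ptopologicalType) (f : S -> T) :
  continuous f ->
  measurable_fun [set: g_sigma_algebraType (@open S)]
    (f : g_sigma_algebraType (@open S) -> g_sigma_algebraType (@open T)).
Proof. by move=> fc _ B mB; rewrite setTI; exact: borel_preimage mB. Qed.

(** * Compatible distances and finite nets in a group *)

Section distances_on_groups.
Context {R : realType} {G : topologicalGroupType} (d : G -> G -> R).
Hypotheses (dd : is_distance d) (dc : compatible_distance d).

Lemma dist_ge0 x y : 0 <= d x y.
Proof.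
have := dist_triangle dd y x x.
by rewrite (dist_xx dd) (dist_sym dd y x); lra.
Qed.

Lemma dist_ball_open h (e : R) : open [set g | d g h < e].
Proof.
rewrite openE => g /= ge; apply/dc; exists (e - d g h); first by lra.
move=> y /= gy; have := dist_triangle dd g y h.
by rewrite (dist_sym dd y g); lra.
Qed.

(** By density, the open balls centred at points of [D] already cover [K]; the net consists of the
    centres of a finite subcover. *)
Lemma compact_finite_net (K D : set G) (e : R) : compact K -> dense D -> 0 < e ->
  exists s : seq G, (forall g, g \in s -> D g) /\
    forall g, K g -> exists2 h, h \in s & d g h < e.
Proof.
move=> cK dD e0.
(* [cover_compact] is used on a pointed space; the identity serves as the point. *)
pose pG : ptopologicalType := HB.pack (Topological.sort G)
  (isPointed.Build (Topological.sort G) (1%g : G)).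
have : @cover_compact pG K by rewrite -compact_cover.
move=> /(_ G D (fun h => [set g | d g h < e])) [|g Kg|s sD sK].
- by move=> h _; exact: dist_ball_open.
- have [h [/= gh Dh]] : [set h | d h g < e] `&` D !=set0.
    apply: dD; first by exists g; rewrite /= (dist_xx dd).
    exact: dist_ball_open.
  by exists h => //=; rewrite (dist_sym dd).
- exists (finmap.enum_fset s).
  split=> [g /sD|g /sK[h /= hs gh]]; first exact: set_mem.
  by exists h.
Qed.

End distances_on_groups.

(** * Bounded actions and the distance modified by an orbit *)

Section bounded_actions.
Context {R : realType} {G : topologicalGroupType} {X : metricType R}
  (act : G -> X -> X).
Hypotheses (hact : is_group_action act) (hbounded : bounded_action act).
Variable d : G -> G -> R.
Hypotheses (dd : is_distance d) (dc : compatible_distance d)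
  (dr : right_invariant d).

(** Right translation by the inverse of [h] brings the pair to the identity and g h^-1. Boundedness
    then applies at the point [act h x], uniformly in [x]. *)
Lemma bounded_action_modulus (e : R) : 0 < e -> exists2 dl : R, 0 < dl &
  forall g h, d g h < dl -> forall x, mdist (act g x) (act h x) < e.
Proof.
move=> /hbounded[U /dc[dl dl0 dlU] Ue]; exists dl => // g h gh x.
have /dlU/Ue : d 1%g (g * h^-1)%g < dl.
  by rewrite -(dr _ _ h) mulgVK mul1g (dist_sym dd).
move=> /(_ (act h x)); rewrite -(actM hact) mulgVK metric_sym.
by [].
Qed.

Definition orbit_dist (x : X) (g h : G) : R :=
  d g h + mdist (act g x) (act h x).

Variable x : X.

Lemma orbit_dist_is_distance : is_distance (orbit_dist x).
Proof.
split=> [g|g h gh|g h|h g k]; rewrite /orbit_dist.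
- by rewrite (dist_xx dd) mdistxx addr0.
- apply: (dist_eq0 dd); apply/eqP; rewrite eq_le (dist_ge0 dd) andbT.
  by rewrite -gh /orbit_dist lerDl mdist_ge0.
- by rewrite (dist_sym dd) metric_sym.
- rewrite addrACA lerD //; first exact: dist_triangle.
  exact: metric_triangle.
Qed.

(** The modulus depends only on [act], [d] and [x], so it serves all the subgroups of the chain at
    once, as [levy_family_uniform_image] demands. *)
Lemma orbit_dist_modulus (e : R) : 0 < e ->
  exists2 dl : R, 0 < dl & forall g h, d g h < dl -> orbit_dist x g h < e.
Proof.
move=> e0; have e2 : 0 < e / 2 by lra.
have [dl dl0 dlP] := bounded_action_modulus e2.
exists (Num.min dl (e / 2)) => [|g h]; rewrite lt_min; first by rewrite dl0.
by move=> /andP[/dlP/(_ x) ? ?]; rewrite /orbit_dist; lra.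
Qed.

Lemma orbit_dist_compatible : compatible_distance (orbit_dist x).
Proof.
move=> g U; split=> [/dc[e e0 eU]|[e e0 eU]].
  exists e => // h /= gh; apply: eU; apply: le_lt_trans gh.
  by rewrite /orbit_dist lerDl mdist_ge0.
have [dl dl0 dlP] := orbit_dist_modulus e0.
by apply/dc; exists dl => // h /dlP; exact: eU.
Qed.

End bounded_actions.

(** * Almost fixed points of Lévy groups *)

(** If [X] were empty, no map into it would exist from the pointed spaces [F n], so every [ObsDiam]
    would be -oo, which does not tend to 0. *)
Lemma property_lozenge_nonempty (R : realType) (X : metricType R)
    (F : nat -> mmSpace R) : levy_family F -> property_lozenge X ->
  exists x : X, True.
Proof.
move=> lF hX; apply: contrapT => X0.
suff : (0 <= -oo :> \bar R)%E by [].
apply: (cvge_to_le (hX F lF 1 ltr01)); apply: nearW => n.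
by apply: ge_ereal_sup => y [f]; case: X0; exists (f point).
Qed.

Lemma unif_continuous_continuous (U V : uniformType) (f : U -> V) :
  unif_continuous f -> continuous f.
Proof.
move=> fu x; apply/cvg_entourageP => A /fu /= fA.
by apply: filterS (nbhs_entourage x fA) => y; rewrite /xsection /= inE.
Qed.

Theorem proposition4p3 (R : realType) (G : topologicalGroupType)
    (X : metricType R) (act : G -> X -> X)
    (hG : levy_group R G) (hact : is_group_action act)
    (hbounded : bounded_action act)
    (huniform : acts_by_uniform_isomorphisms act)
    (hX : property_lozenge X) (K : set G) (hK : compact K)
    (e : R) (he : 0 < e) :
  exists x : X, (diam [set act g x | g in K] <= e%:E)%E.
Proof.
have [H [cH [Hinc Hdense [d [dd [dc [mu [dr haar levy]]]]]]]] := hG.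
have [x0 _] := property_lozenge_nonempty levy hX.
pose dd' := orbit_dist_is_distance act dd x0.
pose dc' := orbit_dist_compatible hact hbounded dd dc dr x0.
(* The type of a subgroup space records its distance, so the identity becomes a map from the metric
   of [d] to that of the orbit distance. *)
pose p n (h : subgroup_space dd (cH n)) : subgroup_space dd' (cH n) := h.
have pU (r : R) : 0 < r -> exists2 dl : R, 0 < dl &
    forall n (h k : subgroup_space dd (cH n)),
      mdist h k < dl -> mdist (p n h) (p n k) < r.
  move=> /(orbit_dist_modulus hact hbounded dd dc dr x0)[dl dl0 dlP].
  by exists dl => // n h k; exact: dlP.
have pc n : continuous (p n).
  apply: metric_unif_continuous => r /pU[dl dl0 dlP].
  by exists dl => // h k; exact: dlP.
pose mu' n := finite_pushforward (continuous_borel_measurable (pc n)) (mu n).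
have levy' : levy_family (fun n => subgroup_mm_space dc' (mu' n)).
  pose Xs n := subgroup_mm_space dc (mu n).
  pose Xs' n := subgroup_mm_space dc' (mu' n).
  apply: (@levy_family_uniform_image _ Xs Xs' p _ _ _ levy) => //.
  by move=> n; exact: (haar n).1.
(* The final estimate spends e / 4 at each end on replacing an element of [K] by one of the net, and
   e / 2 on the diameter of [B]. *)
have e4 : 0 < e / 4 by lra.
have [dl dl0 dlP] := bounded_action_modulus hact hbounded dd dc dr e4.
have [s [sH sK]] := compact_finite_net dd dc hK Hdense dl0.
(* The chain increases and [s] is finite, so one stage contains all of [s]. *)
have [N sN] : exists N, forall n, (N <= n)%N -> forall g, g \in s -> H n g.
  have Hmono m n : (m <= n)%N -> H m `<=` H n.
    by move=> /subnK <-; elim: (n - m)%N => // k IHk; apply: subset_trans IHk _.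
  elim: s sH {sK} => [|g s IHs] sH; first by exists 0%N.
  have [|N sN] := IHs; first by move=> h hs; apply: sH; rewrite in_cons hs orbT.
  have [m _ Hg] := sH g (mem_head _ _).
  exists (maxn m N) => n; rewrite geq_max => /andP[mn Nn] h.
  by rewrite in_cons => /predU1P[->|]; [exact: Hmono Hg|exact: sN].
(* The successor makes the total mass of [size s] exceptional sets strictly less than 1, and covers
   empty [s]. *)
pose k : R := (size s).+1%:R^-1.
have k0 : 0 < k by rewrite invr_gt0 ltr0n.
have e2 : 0 < e / 2 by lra.
have [n [Xn Nn]] : exists n,
    (ObsDiam X (subgroup_mm_space dc' (mu' n)) k < (e / 2)%:E)%E /\ (N <= n)%N.
  have [M _ MP] := ereal_cvg0_lt (hX _ levy' _ k0) e2.
  exists (maxn M N); rewrite leq_maxr; split=> //.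
  by apply: MP; rewrite /= leq_maxl.
pose f (h : subgroup_space dd' (cH n)) : X := act (subg_val h) x0.
have fl : lipschitz1 f.
  by move=> h h'; rewrite [leRHS]/(orbit_dist _ _ _ _ _) lerDr (dist_ge0 dd).
have [B [bB muB dB]] := ObsDiam_lt (X := subgroup_mm_space dc' (mu' n)) fl Xn.
have fc : continuous (f \o p n).
  by move=> h; apply: continuous_comp; [exact: pc|exact: lipschitz1_continuous].
pose C g := [set h : subgroup_space dd (cH n) | B (act g (f h))].
(* Here the action by uniform isomorphisms enters: it makes [act g] continuous. *)
have bC g : borel (C g).
  apply: (borel_preimage (f := act g \o (f \o p n))) bB => h.
  apply: continuous_comp; first exact: fc.
  exact: unif_continuous_continuous.
(* [C g] is the left translate of the preimage of [B] by the inverse of [g], which lies in [H n]. *)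
have muC g : H n g -> mu n (C g) = mu n ((f \o p n) @^-1` B).
  move=> Hg; rewrite -[RHS]((haar n).2 g^-1%g); last 2 first.
  - exact: (csubgV (cH n)).
  - exact: borel_preimage bB.
  congr (mu n _); apply/seteqP; split=> [h /= Bh|h /= [k' /= Bk hk]].
    pose gh := (g * subg_val (h : subgroup_space dd (cH n)))%g.
    have Hgh : H n gh.
      by apply: (csubgM (cH n)) => //; exact: set_mem (valP h).
    exists (exist _ gh (mem_set Hgh) : set_type (H n)).
      by move: Bh; rewrite /f /= /C /= /f -(actM hact).
    by rewrite /subg_val /= mulKg.
  by rewrite /C /= /f -(actM hact) [X in act (_ * X)%g _]hk mulVKg.
have n1 : mu n setT = 1%E := (haar n).1.
have [h Ch] : exists h, forall g, g \in s -> C g h.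
  apply: (unit_mass_meet_seq n1 (k := k)) => [g _|g gs|].
  - exact: bC.
  - rewrite (unit_mass_setC_le n1) ?muC; [|exact: sN|exact: bC].
    by move: muB; rewrite [X in (X - _ <= _)%E](_ : _ = 1%E).
  - by rewrite -(mulr_natl k) /k ltr_pdivrMr ?ltr0n // mul1r ltr_nat.
(* The net points [h1] and [h2] near [g1] and [g2] both send [f h] into [B]; two triangle
   inequalities finish. *)
exists (f h); apply: diam_le => [|_ _ [g1 Kg1 <-] [g2 Kg2 <-]]; first exact: ltW.
have [h1 h1s gh1] := sK g1 Kg1.
have [h2 h2s gh2] := sK g2 Kg2.
have b1 := dlP _ _ gh1 (f h).
have := dlP _ _ gh2 (f h); rewrite metric_sym => b2.
have : mdist (act h1 (f h)) (act h2 (f h)) < e / 2.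
  rewrite -lte_fin; apply: le_lt_trans dB.
  by apply: mdist_le_diam; exact: Ch.
have := metric_triangle (act g1 (f h)) (act h1 (f h)) (act g2 (f h)).
have := metric_triangle (act h1 (f h)) (act h2 (f h)) (act g2 (f h)).
by lra.
Qed.
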